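(* A commutative topological inverse semigroup $S$ embeds topologically into $I_{\mathbb{N}}$ if and only if there exists a countable family $\{G_n : n\in\mathbb{N}\}$ of countable groups such that $S$ embeds topologically into the Tychonoff product $\prod_{n\in\mathbb{N}} G_n^0$, where each factor $G_n^0$ is discrete.
   Context: An inverse semigroup is a semigroup $S$ such that for each $x\in S$ there is a unique $x^{-1}\in S$ with $xx^{-1}x=x$ and $x^{-1}xx^{-1}=x^{-1}$. A topological inverse semigroup is an inverse semigroup with a topology for which both multiplication and inversion are continuous. For a semigroup $G$, $G^0$ denotes $G$ with an external zero adjoined. $I_{\mathbb{N}}$ is the symmetric inverse monoid of all partial permutations of $\mathbb{N}$ (bijections between subsets of $\mathbb{N}$) under composition of binary relations (functions act on the right and compose from left to right), with the topology generated by the subbasis consisting of the sets $U_{x,y}=\{h\in I_{\mathbb{N}} : (x,y)\in h\}$, $W_x=\{h\in I_{\mathbb{N}} : x\notin\operatorname{dom}(h)\}$ and $W_x^{-1}=\{h\in I_{\mathbb{N}} : x\notin\operatorname{im}(h)\}$, for $x,y\in\mathbb{N}$. An embedding of semigroups is an injective homomorphism; an embedding $\phi:S\to T$ of topological semigroups is topological if both $\phi$ and $\phi^{-1}:(S)\phi\to S$ are continuous, where $(S)\phi$ has the subspace topology. ''$S$ embeds topologically into $T$'' means such a topological embedding exists. Products of semigroups have coordinatewise multiplication. *)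

(* Defs.v *)
From HB Require Import structures.
From mathcomp Require Import all_boot.
From mathcomp Require Import boolp classical_sets functions cardinality topology.

Set Implicit Arguments.
Unset Strict Implicit.
Unset Printing Implicit Defensive.

Local Open Scope classical_set_scope.
Local Open Scope group_scope.

(* Only carries the two structures; their compatibility is part of
   [topInverseSemigroupType] below. *)
#[short(type="semigroupTopologicalType")]
HB.structure Definition SemigroupTopological :=
  {S of Semigroup S & Topological S}.

HB.mixin Record Semigroup_isInverse S of Semigroup S := {
  sinv : S -> S;
  mul_sinvK : forall x : S, x * sinv x * x = x;
  sinv_mulK : forall x : S, sinv x * x * sinv x = sinv x;
  sinv_unique : forall x y : S, x * y * x = x -> y * x * y = y -> y = sinv x
}.

#[short(type="inverseSemigroupType")]
HB.structure Definition InverseSemigroup :=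
  {S of Semigroup S & Semigroup_isInverse S}.

HB.mixin Record isTopologicalInverseSemigroup S
    of InverseSemigroup S & Topological S := {
  mul_continuous : continuous (fun p : S * S => p.1 * p.2);
  sinv_continuous : continuous (@sinv S)
}.

#[short(type="topInverseSemigroupType")]
HB.structure Definition TopInverseSemigroup :=
  {S of InverseSemigroup S & Topological S & isTopologicalInverseSemigroup S}.

Section Embedding.
Variables S T : semigroupTopologicalType.

(* [g] is the inverse of [f] on [range f], which carries the subspace
   topology of [T] through the canonical topology of [set_type]. *)
Definition topological_embedding (f : S -> T) :=
  [/\ {morph f : x y / x * y}, injective f, continuous f
    & exists2 g : set_type (range f) -> S,
        (forall y, f (g y) = set_val y) & continuous g].

Definition embeds_topologically := exists f : S -> T, topological_embedding f.

End Embedding.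

Section PartialPerm.
Variable X : Type.

Record partial_perm := PartialPerm {
  pperm_graph : set (X * X);
  pperm_fun : forall x y y',
    pperm_graph (x, y) -> pperm_graph (x, y') -> y = y';
  pperm_inj : forall x x' y,
    pperm_graph (x, y) -> pperm_graph (x', y) -> x = x'
}.

HB.instance Definition _ := gen_eqMixin partial_perm.
HB.instance Definition _ := gen_choiceMixin partial_perm.

Lemma partial_permP (f g : partial_perm) :
  pperm_graph f = pperm_graph g -> f = g.
Proof.
case: f g => [f f1 f2] [g g1 g2] /= fg; case: _ / fg g1 g2 => g1 g2.
by rewrite (Prop_irrelevance f1 g1) (Prop_irrelevance f2 g2).
Qed.

Implicit Types f g h : partial_perm.

Definition pperm_dom h : set X := fst @` pperm_graph h.
Definition pperm_im h : set X := snd @` pperm_graph h.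

(* Left-to-right composition: the library's relation composition [_ \; _]
   composes right to left. *)
Definition pperm_comp f g : set (X * X) :=
  [set p | exists2 z, pperm_graph f (p.1, z) & pperm_graph g (z, p.2)].

Lemma pperm_comp_fun f g x y y' :
  pperm_comp f g (x, y) -> pperm_comp f g (x, y') -> y = y'.
Proof.
move=> [/= z fz gz] [/= z' fz' gz'].
by rewrite -(pperm_fun fz fz') in gz'; exact: pperm_fun gz gz'.
Qed.

Lemma pperm_comp_inj f g x x' y :
  pperm_comp f g (x, y) -> pperm_comp f g (x', y) -> x = x'.
Proof.
move=> [/= z fz gz] [/= z' fz' gz'].
by rewrite -(pperm_inj gz gz') in fz'; exact: pperm_inj fz fz'.
Qed.

Definition pperm_mul f g :=
  PartialPerm (@pperm_comp_fun f g) (@pperm_comp_inj f g).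

Lemma pperm_mulA : associative pperm_mul.
Proof.
move=> f g h; apply: partial_permP; apply/seteqP; split=> -[x y].
  by move=> [/= z fz [/= w gw hw]]; exists w => //; exists z.
by move=> [/= w [/= z fz gw] hw]; exists z => //; exists w.
Qed.

HB.instance Definition _ := isSemigroup.Build partial_perm pperm_mulA.

Definition pperm_subbasis : set (set partial_perm) :=
  [set U | [\/ exists x y, U = [set h | pperm_graph h (x, y)],
               exists x, U = [set h | ~ pperm_dom h x] |
               exists x, U = [set h | ~ pperm_im h x] ] ].

HB.instance Definition _ :=
  isSubBaseTopological.Build partial_perm pperm_subbasis id.

End PartialPerm.

Definition I_N := partial_perm nat.
HB.instance Definition _ := SemigroupTopological.on I_N.

(* [None] is the adjoined zero. *)
Definition adjoin_zero (G : Type) := option G.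

HB.instance Definition _ (G : choiceType) := Choice.on (adjoin_zero G).

Section AdjoinZero.
Variable G : semigroupType.

Definition adjoin_zero_mul (x y : adjoin_zero G) : adjoin_zero G :=
  if (x, y) is (Some a, Some b) then Some (a * b) else None.

Lemma adjoin_zero_mulA : associative adjoin_zero_mul.
Proof. by move=> [x|] [y|] [z|] //=; rewrite /adjoin_zero_mul mulgA. Qed.

HB.instance Definition _ := isSemigroup.Build (adjoin_zero G) adjoin_zero_mulA.

End AdjoinZero.

HB.instance Definition _ (S : semigroupType) :=
  Semigroup.copy (discrete_topology S) S.

Section ProdSemigroup.
Variables (I : Type) (T : I -> semigroupTopologicalType).

Definition prod_mul (f g : prod_topology T) : prod_topology T :=
  fun i => f i * g i.

Lemma prod_mulA : associative prod_mul.
Proof.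
by move=> f g h; apply: functional_extensionality_dep => i; exact: mulgA.
Qed.

HB.instance Definition _ := isSemigroup.Build (prod_topology T) prod_mulA.

End ProdSemigroup.

(* Main.v *)
From HB Require Import structures.
Require Import Defs.
From mathcomp Require Import all_boot.
From mathcomp Require Import boolp classical_sets functions cardinality topology.

(** A commutative inverse semigroup of partial permutations is a family of
    regular representations of abelian groups with zero, one on each orbit.

    From partial permutations to groups: let [S] be a commutative inverse
    semigroup of partial permutations of [X], and let [M] be [S] with the
    identity adjoined.  Say that [y] is in the orbit of [x] if some [h] in [M]
    sends [x] to [y].  Because [M] is closed under inverses, [h] and its
    inverse commute, so domains and images agree ([cpm_dom_im]); because [M] is
    commutative, an [h] defined at [x] is defined on the whole orbit of [x]
    ([orbit_sub_dom]) and is determined there by its value at [x]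
    ([orbit_mulP]).  Hence the orbit of [x] is itself an abelian group with
    unit [x], in which [a * b] is the image of [b] under any member of [M] that
    sends [x] to [a].  Recording, for every [x], where [h] sends [x], with the
    zero standing for [x] being outside the domain of [h], is a morphism into
    the product of these groups with zero ([orbit_imageM]).  Over the naturals
    there are countably many orbits to list, each of them countable.

    From groups to partial permutations: a group acts on itself by right
    translations, and its zero acts as the empty map.  Countably many countable
    groups fit side by side into the naturals, so a product of groups with zero
    acts by partial permutations there ([regular_pperm]).

    Topology: in both constructions a subbasic condition on one side (a point
    is sent to a given point, or lies outside the domain) is a condition on one
    coordinate of the other side.  Two maps out of [S] related in this way
    induce the same topology on [S], and [embedding_transfer] turns this into
    the claim that one is a topological embedding when the other is. *)

Local Open Scope classical_set_scope.

Set Implicit Arguments.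
Unset Strict Implicit.
Unset Printing Implicit Defensive.

Local Open Scope group_scope.

(** * Continuity into discrete, product and partial permutation spaces *)

Lemma continuous_discrete (S : topologicalType) (D : discreteTopologicalType)
    (f : S -> D) :
  (forall d, open [set s | f s = d]) -> continuous f.
Proof.
move=> f_open; apply/continuousP => A _.
have -> : f @^-1` A = \bigcup_(d in A) [set s | f s = d].
  by apply/seteqP; split=> s /=; [exists (f s) | case=> d Ad /= ->].
by apply: bigcup_open => d _; exact: f_open.
Qed.

Lemma continuous_prod (S : topologicalType) (I : Type)
    (T : I -> topologicalType) (f : S -> prod_topology T) :
  (forall i, continuous (fun s => f s i)) -> continuous f.
Proof.
move=> f_cont s; apply/cvg_sup => i.
exact: (@continuous_comp_initial _ _ _ (fun g : (forall i, T i) => g i) f).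
Qed.

Lemma open_coordinate_fiber (S : topologicalType) (I : eqType)
    (D : I -> discreteTopologicalType) (f : S -> prod_topology D) :
  continuous f -> forall i d, open [set s | f s i = d].
Proof.
move=> f_cont i d; have /continuousP : continuous (fun s => f s i).
  move=> s.
  apply: (@continuous_comp S (prod_topology D) (D i) f (fun a => a i)).
    exact: f_cont.
  exact: (@proj_continuous _ D i).
by move/(_ [set d]); apply; exact: discrete_open.
Qed.

Section PartialPermTopology.
Variables (S : topologicalType) (X : Type).

Lemma pperm_subbasis_open (A : set (partial_perm X)) :
  @pperm_subbasis X A -> open A.
Proof.
move=> sA; exists [set A]; last exact: bigcup_set1.
by move=> _ ->; exact: (@finI_from1 _ _ (@pperm_subbasis X) id).
Qed.

Lemma open_pperm_graph (x y : X) :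
  open [set h : partial_perm X | pperm_graph h (x, y)].
Proof. by apply: pperm_subbasis_open; constructor 1; exists x, y. Qed.

Lemma open_pperm_notin_dom (x : X) :
  open [set h : partial_perm X | ~ pperm_dom h x].
Proof. by apply: pperm_subbasis_open; constructor 2; exists x. Qed.

Lemma continuous_pperm (f : S -> partial_perm X) :
    (forall x y, open [set s | pperm_graph (f s) (x, y)]) ->
    (forall x, open [set s | ~ pperm_dom (f s) x]) ->
    (forall x, open [set s | ~ pperm_im (f s) x]) ->
  continuous f.
Proof.
move=> f_graph f_dom f_im; apply/continuousP => A [D D_sub <-].
rewrite preimage_bigcup; apply: bigcup_open => B DB.
have [F F_sub <-] := D_sub _ DB.
rewrite bigcap_fset big_seq.
apply: (big_ind (fun U => open (f @^-1` U))) => [|U V|U /F_sub/set_mem].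
- by rewrite preimage_setT; exact: openT.
- by rewrite preimage_setI; exact: openI.
- move=> DU; have [[x [y ->]]|[x ->]|[x ->]] := DU : pperm_subbasis U.
  + exact: f_graph.
  + exact: f_dom.
  + exact: f_im.
Qed.

End PartialPermTopology.

(** The initial topologies on [S] of an embedding and of a continuous map [f]
    agree once [phi] is continuous for the one induced by [f]; so the question
    whether the inverse of [f] is continuous becomes a question about a map into
    [T], which can be settled on a subbasis of [T]. *)
Lemma embedding_transfer (S T T' : semigroupTopologicalType)
    (phi : S -> T) (f : S -> T') :
  topological_embedding phi -> {morph f : x y / x * y} -> injective f ->
  continuous f -> continuous (phi : initial_topology f -> T) ->
  topological_embedding f.
Proof.
move=> [_ phi_inj _ [g gK g_cont]] fM f_inj f_cont phi_cont; split=> //.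
have fP (y : set_type (range f)) : {s | f s = set_val y}.
  by apply: cid; have [s _ fs] := set_valP y; exists s; rewrite fs.
exists (fun y => sval (fP y)); first by move=> y; exact: svalP (fP y).
apply/continuousP => A oA.
have [B oB BE] := (continuousP _).1 g_cont A oA.
have [C oC CE] := (continuousP _).1 phi_cont B oB.
have AE s : A s <-> C (f s).
  have Rs : phi s \in range phi by apply/mem_set; exists s.
  have gs : g (SigSub Rs) = s by apply: phi_inj; rewrite gK.
  rewrite -{1}gs -[A _]/((g @^-1` A) _) -BE /= -[C _]/((f @^-1` C) s) CE.
  by [].
(* The open set [A] is the preimage under [f] of [C], hence [C] is the trace on
   the range of [f] that the inverse of [f] pulls [A] back to. *)
exists C => //; apply/seteqP; split=> y /=.
  by move=> Cy; apply/AE; rewrite (svalP (fP y)).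
by move=> /AE; rewrite (svalP (fP y)).
Qed.

(** * Products of groups with zero act by partial permutations *)

(** The map [c] embeds the disjoint union of the groups [G n] into [X]: its two
    hypotheses say that it separates distinct groups and points of one group. *)
Section RegularRepresentation.
Variables (X : Type) (I : eqType) (G : I -> groupType).
Variable c : forall n, G n -> X.
Hypothesis c_idx : forall n m (h : G n) (k : G m), c h = c k -> n = m.
Hypothesis c_inj : forall n, injective (@c n).

Implicit Types a b : forall n, adjoin_zero (G n).

(** Each nonzero coordinate acts on the copy of its group by right translation;
    a zero coordinate leaves its copy outside the domain. *)
Definition regular_graph a : set (X * X) :=
  [set p | exists n (h g : G n),
    [/\ p.1 = c h, p.2 = c (h * g) & a n = Some g]].

Lemma regular_graphP a n (h : G n) y :
  regular_graph a (c h, y) <-> exists2 g, y = c (h * g) & a n = Some g.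
Proof.
split=> [[m [h' [g /= [hh' -> ag]]]]|[g -> ag]]; last by exists n, h, g.
(* Eliminating [nm] identifies the two groups, so that [c_inj] applies. *)
move: (c_idx hh') => nm; case: _ / nm h' g hh' ag => h' g /c_inj <- ag.
by exists g.
Qed.

Lemma regular_graph_fun a x y y' :
  regular_graph a (x, y) -> regular_graph a (x, y') -> y = y'.
Proof.
move=> [n [h [g /= [-> -> ag]]]] /regular_graphP [g' ->].
by rewrite ag => -[->].
Qed.

Lemma regular_graph_inj a x x' y :
  regular_graph a (x, y) -> regular_graph a (x', y) -> x = x'.
Proof.
move=> [n [h [g /= [-> -> ag]]]] [m [h' [g' /= [-> e ag']]]].
move: (c_idx e) => nm; case: _ / nm h' g' e ag' => h' g'.
by rewrite ag => /c_inj hg [gg]; rewrite -gg in hg; rewrite (mulIg _ _ _ hg).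
Qed.

Definition regular_pperm a :=
  PartialPerm (@regular_graph_fun a) (@regular_graph_inj a).

(** The representation is regular: one point and its image recover the
    coordinate. *)
Lemma regular_ppermE a n (h k : G n) :
  pperm_graph (regular_pperm a) (c h, c k) <-> a n = Some (h^-1 * k).
Proof.
split=> [/regular_graphP [g /c_inj -> ->]|ag]; first by rewrite mulKg.
by apply/regular_graphP; exists (h^-1 * k); rewrite // mulVKg.
Qed.

Lemma regular_pperm_dom a n (h : G n) :
  ~ pperm_dom (regular_pperm a) (c h) <-> a n = None.
Proof.
split=> [ndom|an [[x y] /= xy xE]].
  case E : (a n) => [g|//]; case: ndom.
  by exists (c h, c (h * g)) => //; apply/regular_ppermE; rewrite mulKg.
by move: xy; rewrite xE => /regular_graphP [g _]; rewrite an.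
Qed.

Lemma regular_pperm_im a n (h : G n) :
  ~ pperm_im (regular_pperm a) (c h) <-> a n = None.
Proof.
split=> [nim|an [[x y] /= xy yE]].
  case E : (a n) => [g|//]; case: nim.
  exists (c (h * g^-1), c h) => //.
  by apply/regular_ppermE; rewrite invgM invgK mulgVK.
move: xy; rewrite yE => -[m [h' [g /= [_ e]]]].
by move: (c_idx e) => nm; case: _ / nm h' g {e}; rewrite an.
Qed.

Lemma regular_ppermM a b :
  regular_pperm (fun n => adjoin_zero_mul (a n) (b n)) =
  regular_pperm a * regular_pperm b.
Proof.
apply: partial_permP; apply/seteqP; split=> -[x y].
  move=> [n [h [g /= [-> ->]]]]; rewrite /adjoin_zero_mul.
  case ag : (a n) => [g1|//]; case bg : (b n) => [g2|//] [<-].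
  exists (c (h * g1)); apply/regular_ppermE; first by rewrite mulKg.
  by rewrite (mulgA h) mulKg.
move=> [/= z [n [h [g /= [-> -> ag]]]] /regular_graphP [g' -> bg]].
by apply/regular_graphP; exists (g * g'); rewrite ?mulgA // ag bg.
Qed.

Lemma regular_pperm_injective a b :
  regular_pperm a = regular_pperm b -> a = b.
Proof.
move=> ab; apply: functional_extensionality_dep => n.
case E : (a n) => [g|]; last first.
  apply/esym/(regular_pperm_dom b (1 : G n)).
  by rewrite -ab; apply/regular_pperm_dom.
have : pperm_graph (regular_pperm a) (c (1 : G n), c g).
  by apply/regular_ppermE; rewrite invg1 mul1g.
by rewrite ab => /regular_ppermE; rewrite invg1 mul1g.
Qed.

Lemma coded_or_not x :
  (exists n (h : G n), x = c h) \/ (forall n (h : G n), x <> c h).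
Proof.
have [|nx] := pselect (exists n (h : G n), x = c h); first by left.
by right=> n h xE; apply: nx; exists n, h.
Qed.

Section Topology.
Variables (S : topologicalType).
Let D n : discreteTopologicalType := discrete_topology (adjoin_zero (G n)).
Variable f : S -> forall n, adjoin_zero (G n).

Lemma continuous_regular_pperm :
  continuous (f : S -> prod_topology D) -> continuous (regular_pperm \o f).
Proof.
move=> f_cont.
have f_open n d : open [set s | f s n = d].
  exact: (@open_coordinate_fiber _ _ D f).
apply: continuous_pperm => [x y|x|x].
- have [[n [h ->]]|nx] := coded_or_not x.
    have [[k ->]|ny] := pselect (exists k : G n, y = c k).
      rewrite (_ : [set s | _] = [set s | f s n = Some (h^-1 * k)]) //.
      by apply/seteqP; split=> s /regular_ppermE.
    rewrite (_ : [set s | _] = set0); first exact: open0.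
    apply/seteqP; split=> s // /regular_graphP [g yE _].
    by case: ny; exists (h * g).
  rewrite (_ : [set s | _] = set0); first exact: open0.
  by apply/seteqP; split=> s // [n [h [g [/= /nx]]]].
- have [[n [h ->]]|nx] := coded_or_not x.
    rewrite (_ : [set s | _] = [set s | f s n = None]) //.
    by apply/funext=> s; apply/propext; exact: regular_pperm_dom.
  rewrite (_ : [set s | _] = setT); first exact: openT.
  apply/seteqP; split=> s // _ [[x' y] /= [n [h [g [/= -> _ _]]]] xE].
  exact: nx (esym xE).
- have [[n [h ->]]|nx] := coded_or_not x.
    rewrite (_ : [set s | _] = [set s | f s n = None]) //.
    by apply/funext=> s; apply/propext; exact: regular_pperm_im.
  rewrite (_ : [set s | _] = setT); first exact: openT.
  apply/seteqP; split=> s // _ [[x' y] /= [n [h [g [/= _ -> _]]]] xE].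
  exact: nx (esym xE).
Qed.

Lemma continuous_of_regular_pperm :
  continuous (regular_pperm \o f) -> continuous (f : S -> prod_topology D).
Proof.
move=> /continuousP f_open; apply: continuous_prod => n.
apply: continuous_discrete => -[g|].
  rewrite (_ : [set s | _] =
    (regular_pperm \o f) @^-1` [set h | pperm_graph h (c (1 : G n), c g)]).
    by exact/f_open/open_pperm_graph.
  apply/funext=> s; apply/propext; apply: iff_sym.
  by have := regular_ppermE (f s) (1 : G n) g; rewrite invg1 mul1g.
rewrite (_ : [set s | _] =
  (regular_pperm \o f) @^-1` [set h | ~ pperm_dom h (c (1 : G n))]).
  by exact/f_open/open_pperm_notin_dom.
by apply/funext=> s; apply/propext; apply: iff_sym; exact: regular_pperm_dom.
Qed.

End Topology.
End RegularRepresentation.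

(** Countability of the groups is what makes room for all of them in the
    naturals, through a pairing of the index with a code of the element. *)
Lemma embeds_prod_pperm (S : topInverseSemigroupType) (G : nat -> groupType) :
  (forall n, countable [set: G n]) ->
  embeds_topologically S
    (prod_topology (fun n => discrete_topology (adjoin_zero (G n)))) ->
  embeds_topologically S I_N.
Proof.
move=> G_countable [phi phiE].
have [e e_inj] : {e : forall n, G n -> nat & forall n, injective (e n)}.
  have e_ n : {e : G n -> nat | injective e}.
    have /countable_injP/cid [e e_inj] := G_countable n.
    by exists e => h k; apply: e_inj; exact: in_setT.
  by exists (fun n => sval (e_ n)) => n; exact: svalP (e_ n).
pose c n (h : G n) := pickle (n, e n h).
have cE n m (h : G n) (k : G m) : c n h = c m k -> (n, e n h) = (m, e m k).
  exact: (pcan_inj pickleK).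
have c_idx n m (h : G n) (k : G m) : c n h = c m k -> n = m by move=> /cE [].
have c_inj n : injective (c n) by move=> h k /cE [] /e_inj.
exists (regular_pperm c_idx c_inj \o phi).
have [phiM phi_inj phi_cont _] := phiE.
apply: (embedding_transfer phiE).
- by move=> s t /=; rewrite phiM -regular_ppermM.
- by move=> s t /= /regular_pperm_injective /phi_inj.
- exact: (@continuous_regular_pperm _ _ _ _ c_idx c_inj).
- apply: (@continuous_of_regular_pperm _ _ _ _ c_idx c_inj).
  exact: initial_continuous.
Qed.

(** * Inverses of partial permutations *)

Section PartialPermInverse.
Variable X : Type.
Implicit Types f g h : partial_perm X.

Definition pperm_id : partial_perm X.
Proof. by exists [set p | p.1 = p.2] => [x y y'|x x' y] /= -> // ->. Defined.

Definition pperm_inv h : partial_perm X.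
Proof.
exists [set p | pperm_graph h (p.2, p.1)] => [x y y'|x x' y] /=.
- exact: pperm_inj.
- exact: pperm_fun.
Defined.

Lemma pperm_id_mul h : pperm_id * h = h.
Proof.
apply: partial_permP; apply/seteqP; split=> -[x y]; first by case=> z /= ->.
by exists x.
Qed.

Lemma pperm_mul_id h : h * pperm_id = h.
Proof.
apply: partial_permP; apply/seteqP; split=> -[x y]; first by case=> z /= + <-.
by exists y.
Qed.

Lemma pperm_inv_id : pperm_inv pperm_id = pperm_id.
Proof. by apply: partial_permP; apply/seteqP; split=> -[x y] /= ->. Qed.

(** Inverses in the semigroup sense are converses of relations: if [h] sends [x]
    to [y], then [h * k * h = h] forces [k] to send [y] back to [x]. *)
Lemma pperm_invE f g : f * g * f = f -> g * f * g = g -> g = pperm_inv f.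
Proof.
have sub (h k : partial_perm X) x y : h * k * h = h ->
    pperm_graph h (x, y) -> pperm_graph k (y, x).
  move=> hkh hxy; have := hxy; rewrite -{1}hkh => -[/= w [/= z hxz kzw] hwy].
  by rewrite (pperm_fun hxy hxz) (pperm_inj hxy hwy).
move=> fgf gfg; apply: partial_permP; apply/seteqP.
by split=> -[x y] /=; exact: sub.
Qed.

End PartialPermInverse.

Arguments pperm_id {X}.

(** * Orbits of a commutative inverse monoid of partial permutations *)

(** Having the identity in the monoid puts every point into its own orbit, also
    the points outside all the domains, whose orbit is then the trivial group. *)
Record comm_pperm_monoid X := CommPpermMonoid {
  cpm_set :> partial_perm X -> Prop;
  cpm1 : cpm_set pperm_id;
  cpmM : forall h k, cpm_set h -> cpm_set k -> cpm_set (h * k);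
  cpmV : forall h, cpm_set h -> cpm_set (pperm_inv h);
  cpmC : forall h k, cpm_set h -> cpm_set k -> h * k = k * h
}.

Definition pperm_orbit X (M : comm_pperm_monoid X) (x : X) :=
  set_type [set y | exists2 h, M h & pperm_graph h (x, y)].

HB.instance Definition _ (X : choiceType) (M : comm_pperm_monoid X) (x : X) :=
  Choice.on (pperm_orbit M x).

Section OrbitGroup.
Variables (X : choiceType) (M : comm_pperm_monoid X).
Implicit Types h k : partial_perm X.

(** The idempotents [h * pperm_inv h] and [pperm_inv h * h] are the identities
    of the domain and of the image of [h]; commutativity equates them. *)
Lemma cpm_dom_im h x : M h -> pperm_dom h x -> pperm_im h x.
Proof.
move=> Mh [[x' y] /= hxy <-].
have : pperm_graph (h * pperm_inv h) (x', x') by exists y.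
by rewrite (@cpmC _ M) //; [move=> [z /= hzx _]; exists (z, x') | exact: cpmV].
Qed.

Lemma cpm_im_dom h x : M h -> pperm_im h x -> pperm_dom h x.
Proof.
move=> Mh [[y x'] /= hyx <-].
have : pperm_graph (pperm_inv h * h) (x', x') by exists y.
by rewrite (@cpmC _ M) //; [move=> [z /= hzx _]; exists (x', z) | exact: cpmV].
Qed.

Variable x : X.
Local Notation O := (pperm_orbit M x).
Implicit Types a b : O.

Lemma orbit_point h y : M h -> pperm_graph h (x, y) -> {a : O | set_val a = y}.
Proof.
move=> Mh hxy.
have Oy : y \in [set y | exists2 h, M h & pperm_graph h (x, y)].
  by apply/mem_set; exists h.
by exists (SigSub Oy).
Qed.

Lemma orbit_reached a : exists2 h, M h & pperm_graph h (x, set_val a).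
Proof. exact: set_valP a. Qed.

(** If [k] sends [x] to [b] and [h] is defined at [x], then [h * pperm_inv h]
    fixes [x]; moving this idempotent past [k] shows that it fixes [b]. *)
Lemma orbit_sub_dom h a b : M h -> pperm_graph h (x, set_val a) ->
  exists c : O, pperm_graph h (set_val b, set_val c).
Proof.
move=> Mh hxa; have [k Mk kxb] := orbit_reached b.
have MhV : M (h * pperm_inv h) by apply: cpmM => //; exact: cpmV.
have : pperm_graph (h * pperm_inv h * k) (x, set_val b).
  by exists x => //; exists (set_val a).
rewrite (cpmC MhV Mk) => -[/= y kxy [/= z hyz hbz]].
have [|c cz] := @orbit_point (k * h) z (cpmM Mk Mh).
  by exists y.
by exists c; rewrite cz.
Qed.

Lemma orbit_mul_ex a b :
  exists c : O, exists2 h, M h & pperm_graph h (x, set_val a) /\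
                                 pperm_graph h (set_val b, set_val c).
Proof.
have [h Mh hxa] := orbit_reached a.
by have [c hbc] := orbit_sub_dom b Mh hxa; exists c, h.
Qed.

Definition orbit_mul a b : O := sval (cid (orbit_mul_ex a b)).

(** The product does not depend on the member of the monoid chosen to send [x]
    to [a]: with [k] sending [x] to [b], both choices send [b] to the image of
    [a] under [k]. *)
Lemma orbit_mulP h a b : M h -> pperm_graph h (x, set_val a) ->
  pperm_graph h (set_val b, set_val (orbit_mul a b)).
Proof.
move=> Mh hxa; rewrite /orbit_mul; case: cid => c /= [h' Mh' [h'xa h'bc]].
have [k Mk kxb] := orbit_reached b.
have : pperm_graph (k * h') (x, set_val c) by exists (set_val b).
rewrite (@cpmC _ M) // => -[/= y h'xy kyc].
rewrite -(pperm_fun h'xa h'xy) in kyc.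
have : pperm_graph (h * k) (x, set_val c) by exists (set_val a).
by rewrite (@cpmC _ M) // => -[/= z kxz hzc]; rewrite (pperm_fun kxb kxz).
Qed.

Lemma orbit_val_inj : injective (set_val : O -> X).
Proof. exact: val_inj. Qed.

Lemma orbit_mulC : commutative orbit_mul.
Proof.
move=> a b; apply: orbit_val_inj.
have [h Mh hxa] := orbit_reached a; have [k Mk kxb] := orbit_reached b.
have : pperm_graph (h * k) (x, set_val (orbit_mul b a)).
  by exists (set_val a) => //; exact: orbit_mulP.
rewrite (@cpmC _ M) // => -[/= y kxy hy]; rewrite -(pperm_fun kxb kxy) in hy.
by apply: pperm_fun hy; exact: orbit_mulP.
Qed.

Lemma orbit_mulA : associative orbit_mul.
Proof.
move=> a b c; apply: orbit_val_inj.
have [h Mh hxa] := orbit_reached a; have [k Mk kxb] := orbit_reached b.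
have kh_ab : pperm_graph (k * h) (x, set_val (orbit_mul a b)).
  by exists (set_val b) => //; exact: orbit_mulP.
have [/= y kcy hy] := orbit_mulP c (cpmM Mk Mh) kh_ab.
rewrite -(pperm_fun (orbit_mulP c Mk kxb) kcy) in hy.
by apply: pperm_fun hy; exact: orbit_mulP.
Qed.

Definition orbit_one : O := sval (orbit_point (cpm1 M) (erefl x)).

Lemma orbit_oneE : set_val orbit_one = x.
Proof. exact: svalP (orbit_point (cpm1 M) (erefl x)). Qed.

Lemma orbit_mul1 : left_id orbit_one orbit_mul.
Proof.
move=> a; apply: orbit_val_inj.
by apply/esym/(orbit_mulP a (cpm1 M)); rewrite orbit_oneE.
Qed.

(** The inverse of [a] is the preimage of [x] under a member [h] sending [x] to
    [a]; it exists because [x], being in the domain of [h], is in its image. *)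
Lemma orbit_inv_ex a : exists b, orbit_mul b a = orbit_one.
Proof.
have [h Mh hxa] := orbit_reached a.
have [[y x'] /= hyx x'E] : pperm_im h x.
  by apply: cpm_dom_im => //; exists (x, set_val a).
rewrite {}x'E in hyx.
have [b bE] := @orbit_point (pperm_inv h) y (cpmV Mh) hyx.
exists b; apply: orbit_val_inj; rewrite orbit_oneE orbit_mulC.
by apply: pperm_fun (orbit_mulP b Mh hxa) _; rewrite bE.
Qed.

Definition orbit_inv a : O := sval (cid (orbit_inv_ex a)).

Lemma orbit_mulV : left_inverse orbit_one orbit_inv orbit_mul.
Proof. by move=> a; rewrite /orbit_inv; case: cid. Qed.

Lemma orbit_mulr1 : right_id orbit_one orbit_mul.
Proof. by move=> a; rewrite orbit_mulC orbit_mul1. Qed.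

Lemma orbit_mulrV : right_inverse orbit_one orbit_inv orbit_mul.
Proof. by move=> a; rewrite orbit_mulC orbit_mulV. Qed.

HB.instance Definition _ := isGroup.Build O
  orbit_mulA orbit_mul1 orbit_mulr1 orbit_mulV orbit_mulrV.

Definition orbit_image h : adjoin_zero O :=
  if pselect (exists a : O, pperm_graph h (x, set_val a)) is left ex_a
  then Some (sval (cid ex_a)) else None.

Lemma orbit_imageE h a :
  orbit_image h = Some a <-> pperm_graph h (x, set_val a).
Proof.
rewrite /orbit_image; case: pselect => [ex_a|nex].
  case: cid => b hb /=; split=> [[<-]//|ha].
  by congr Some; apply: orbit_val_inj; exact: pperm_fun hb ha.
by split=> // ha; case: nex; exists a.
Qed.

Lemma orbit_image_None h : M h -> orbit_image h = None <-> ~ pperm_dom h x.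
Proof.
move=> Mh; case E : (orbit_image h) => [a|].
  split=> // ndom; case: ndom; exists (x, set_val a) => //.
  exact/orbit_imageE.
split=> // _ [[x' y] /= hxy x'E]; rewrite {}x'E in hxy.
have [a aE] := orbit_point Mh hxy.
by have /orbit_imageE : pperm_graph h (x, set_val a); rewrite ?aE // E.
Qed.

(** If [h] sends [x] to [a] and [k] sends [x] to [b], then [k * h] sends [x] to
    the image of [b] under [h], which is [orbit_mul a b]; commutativity replaces
    [k * h] by [h * k]. *)
Lemma orbit_imageM h k : M h -> M k ->
  orbit_image (h * k) = adjoin_zero_mul (orbit_image h) (orbit_image k).
Proof.
move=> Mh Mk; rewrite /adjoin_zero_mul.
case hE : (orbit_image h) => [a|].
  case kE : (orbit_image k) => [b|].
    move/orbit_imageE in hE; move/orbit_imageE in kE.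
    apply/orbit_imageE; rewrite (@cpmC _ M) //.
    by exists (set_val b) => //; exact: orbit_mulP.
  move/(orbit_image_None Mk) in kE; apply/(orbit_image_None (cpmM Mh Mk)).
  rewrite (@cpmC _ M) // => -[[x' y] [/= z kxz _] x'E]; apply: kE.
  by exists (x', z).
move/(orbit_image_None Mh) in hE; apply/(orbit_image_None (cpmM Mh Mk)).
by move=> [[x' y] [/= z hxz _] x'E]; apply: hE; exists (x', z).
Qed.

End OrbitGroup.

Section OrbitTopology.
Variables (X : choiceType) (M : comm_pperm_monoid X).
Variables (S : topologicalType) (f : S -> partial_perm X).
Hypothesis fM : forall s, M (f s).
Let D x : discreteTopologicalType :=
  discrete_topology (adjoin_zero (pperm_orbit M x)).
Let F : S -> prod_topology D := fun s x => orbit_image M x (f s).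

Lemma continuous_orbit_image : continuous f -> continuous F.
Proof.
move=> /continuousP f_open; apply: continuous_prod => x.
apply: continuous_discrete => -[a|].
  rewrite (_ : [set s | _] = f @^-1` [set h | pperm_graph h (x, set_val a)]).
    by exact/f_open/open_pperm_graph.
  by apply/funext=> s; apply/propext; exact: orbit_imageE.
rewrite (_ : [set s | _] = f @^-1` [set h | ~ pperm_dom h x]).
  by exact/f_open/open_pperm_notin_dom.
by apply/funext=> s; apply/propext; exact: orbit_image_None.
Qed.

Lemma continuous_of_orbit_image : continuous F -> continuous f.
Proof.
move=> F_cont.
have F_open x d : open [set s | orbit_image M x (f s) = d].
  exact: (@open_coordinate_fiber _ _ D F).
have dom_open x : open [set s | ~ pperm_dom (f s) x].
  rewrite (_ : [set s | _] = [set s | orbit_image M x (f s) = None]) //.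
  apply/funext=> s; apply/propext; apply: iff_sym; exact: orbit_image_None.
apply: continuous_pperm => // [x y|x].
  have [[h Mh hxy]|nO] := pselect (exists2 h, M h & pperm_graph h (x, y)).
    have [a <-] := orbit_point Mh hxy.
    rewrite (_ : [set s | _] = [set s | orbit_image M x (f s) = Some a]) //.
    by apply/funext=> s; apply/propext; apply: iff_sym; exact: orbit_imageE.
  rewrite (_ : [set s | _] = set0); first exact: open0.
  by apply/seteqP; split=> s // fxy; apply: nO; exists (f s).
(* The conditions on images are not recorded by [F], but reduce to those on
   domains. *)
rewrite (_ : [set s | _] = [set s | ~ pperm_dom (f s) x]) //.
apply/seteqP; split=> s /= nP Q; apply: nP.
  exact: (@cpm_dom_im _ M).
exact: (@cpm_im_dom _ M).
Qed.

End OrbitTopology.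

(** * From an embedding into partial permutations to orbit groups *)

Section UnitalImage.
Variables (S : topInverseSemigroupType) (X : Type) (phi : S -> partial_perm X).
Hypothesis S_comm : commutative (@mul S).
Hypothesis phiM : {morph phi : s t / s * t}.

Definition unital_image : comm_pperm_monoid X.
Proof.
exists (fun h => h = pperm_id \/ range phi h).
- by left.
- move=> h k [->|[s _ <-]]; first by rewrite pperm_id_mul.
  case=> [->|[t _ <-]]; first by rewrite pperm_mul_id; right; exists s.
  by right; exists (s * t).
- move=> h [->|[s _ <-]]; first by left; exact: pperm_inv_id.
  right; exists (sinv s) => //; apply: pperm_invE.
    by rewrite -!phiM mul_sinvK.
  by rewrite -!phiM sinv_mulK.
- move=> h k [->|[s _ <-]]; first by rewrite pperm_id_mul pperm_mul_id.
  case=> [->|[t _ <-]]; first by rewrite pperm_id_mul pperm_mul_id.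
  by rewrite -!phiM S_comm.
Defined.

Lemma unital_imageP s : unital_image (phi s).
Proof. by right; exists s. Qed.

End UnitalImage.

Lemma embeds_pperm_prod (S : topInverseSemigroupType) :
  commutative (@mul S) -> embeds_topologically S I_N ->
  exists G : nat -> groupType,
    (forall n, countable [set: G n]) /\
    embeds_topologically S
      (prod_topology (fun n => discrete_topology (adjoin_zero (G n)))).
Proof.
move=> S_comm [phi phiE]; have [phiM phi_inj phi_cont _] := phiE.
pose M := unital_image S_comm phiM.
have MP s : M (phi s) := unital_imageP S_comm phiM s.
exists (fun n => pperm_orbit M n); split=> [n|].
  apply/countable_injP; exists set_val => a b _ _; exact: orbit_val_inj.
exists (fun s n => orbit_image M n (phi s)).
apply: (embedding_transfer phiE).
- move=> s t; apply: functional_extensionality_dep => n.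
  by rewrite phiM; exact: orbit_imageM.
- move=> s t st; apply: phi_inj.
  have sub s' t' :
      (forall n, orbit_image M n (phi s') = orbit_image M n (phi t')) ->
      pperm_graph (phi s') `<=` pperm_graph (phi t').
    move=> st' [x y] sxy; have [a aE] := orbit_point (MP s') sxy.
    by move: sxy; rewrite -aE => /orbit_imageE; rewrite st' => /orbit_imageE.
  have stE n : orbit_image M n (phi s) = orbit_image M n (phi t).
    exact: (congr1 (fun F : forall n, adjoin_zero (pperm_orbit M n) => F n) st).
  by apply: partial_permP; apply/seteqP; split; apply: sub.
- exact: (@continuous_orbit_image _ M).
- apply: (@continuous_of_orbit_image _ M) => //.
  exact: initial_continuous.
Qed.

Theorem theorem2p2 (S : topInverseSemigroupType)
    (S_comm : commutative (@mul S)) :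
  embeds_topologically S I_N <->
  exists G : nat -> groupType,
    (forall n, countable [set: G n]) /\
    embeds_topologically S
      (prod_topology (fun n => discrete_topology (adjoin_zero (G n)))).
Proof.
split; first exact: embeds_pperm_prod.
by move=> [G [G_countable]]; exact: embeds_prod_pperm.
Qed.
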